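(* Let $\mathfrak q$ be a Lie algebra over $\mathbb K$ and let $p=p_1\in\mathbb K[t]$ be a monic polynomial of degree $n\ge2$. Suppose that $p_2=p_1+l$, where $l\in\mathbb K[t]$ is a nonzero polynomial of degree at most $1$. Then the brackets $[\,,]_{p_1}$ and $[\,,]_{p_2}$ on $\mathbb W$ are compatible.
   Context: $\mathbb K$ is an algebraically closed field of characteristic $0$. For a monic $p\in\mathbb K[t]$ of degree $n$, the Lie algebra $\mathfrak q[t]/(p)=\mathfrak q\otimes(\mathbb K[t]/(p))$ (bracket $[xf,yg]=[x,y]fg$) is identified, as a vector space, with $\mathbb W=\mathfrak q\cdot 1\oplus\mathfrak q\bar t\oplus\dots\oplus\mathfrak q\bar t^{\,n-1}$, where $\bar t=t+(p)$; $[\,,]_p$ denotes the resulting Lie bracket on $\mathbb W$. Two Lie brackets on $\mathbb W$ are compatible if their sum (equivalently, any linear combination of them) is again a Lie bracket. *)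

(* Defs.v *)
From HB Require Import structures.
From mathcomp Require Import all_boot all_order all_algebra.

Set Implicit Arguments.
Unset Strict Implicit.
Unset Printing Implicit Defensive.

Import GRing.Theory.
Local Open Scope ring_scope.

Section LieBrackets.

Variables (K : fieldType) (V : lmodType K).
Implicit Types b c : V -> V -> V.

Definition lie_bracket b : Prop :=
  [/\ bilinear_for *:%R *:%R b,
      forall x, b x x = 0 &
      forall x y z, b x (b y z) + b y (b z x) + b z (b x y) = 0].

Definition add_bracket b c : V -> V -> V := fun x y => b x y + c x y.

Definition compatible_brackets b c : Prop :=
  [/\ lie_bracket b, lie_bracket c & lie_bracket (add_bracket b c)].

End LieBrackets.

(* W = q.1 + q.tbar + ... + q.tbar^(n-1); the value at i of an element is its
   coefficient at tbar^i. *)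
Notation currents q n := {ffun 'I_n -> q}.

Section QuotientCurrentBracket.

Variables (K : fieldType) (q : lmodType K).

(* The element x f of q (x) K[t]/(p), seen in W through the coordinates of f
   in the basis 1, tbar, ..., tbar^(n-1).  Here p is meant to be monic of
   degree n > 0: the library type {poly %/ p} is K[t]/(p) for such p (and
   K[t]/(t) for p not monic or constant). *)
Definition pure_current n (p : {poly K}) (x : q) (f : {poly %/ p}) :
    currents q n :=
  [ffun i : 'I_n => (f : {poly K})`_i *: x].

(* The bilinear map on W with [x tbar^i, y tbar^j]_p = [x, y] tbar^i tbar^j,
   the product being taken in K[t]/(p). *)
Definition quot_bracket (br : q -> q -> q) n (p : {poly K})
    (u v : currents q n) : currents q n :=
  \sum_(i < n) \sum_(j < n)
     pure_current n (br (u i) (v j)) ((in_qpoly p 'X) ^+ i * (in_qpoly p 'X) ^+ j).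

End QuotientCurrentBracket.

Section QuotientCurrentTheory.

Variables (K : fieldType) (q : lmodType K) (n : nat) (p : {poly K}).
Hypotheses (p_monic : p \is monic) (size_p : size p = n.+1) (n_gt0 : (0 < n)%N).

Local Notation tbar := (in_qpoly p 'X).

Let mk_monicE : mk_monic p = p.
Proof. by rewrite /mk_monic size_p p_monic ltnS n_gt0. Qed.

Lemma tbarXE (i : 'I_n) : (tbar ^+ i : {poly %/ p}) = 'X^i :> {poly K}.
Proof.
have -> : tbar ^+ i = in_qpoly p 'X^i.
  elim: (i : nat) => [|k IH]; first by rewrite !expr0 in_qpoly1.
  by rewrite !exprS IH in_qpolyM.
by rewrite in_qpoly_small // mk_monicE size_polyXn size_p ltnS ltn_ord.
Qed.

Lemma qpoly_tbarE (f : {poly %/ p}) :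
  f = \sum_(i < n) (f : {poly K})`_i *: tbar ^+ i.
Proof.
apply: val_inj => /=; rewrite poly_of_qpoly_sum.
under eq_bigr => i _ do rewrite poly_of_qpolyZ tbarXE.
rewrite -poly_def; apply/polyP => k; rewrite coef_poly.
case: ltnP => // le_nk; apply: nth_default.
by rewrite (leq_trans _ le_nk) // -ltnS -size_p -{2}mk_monicE size_mk_monic.
Qed.

Lemma currents_tbarE (w : currents q n) :
  w = \sum_(i < n) pure_current n (w i) (tbar ^+ i).
Proof.
apply/ffunP => k; rewrite sum_ffunE (bigD1 k) //= big1 => [|i ne_ik].
  by rewrite ffunE tbarXE coefXn eqxx scale1r addr0.
by rewrite ffunE tbarXE coefXn eq_sym (negPf (ne_ik : (i : nat) != k)) scale0r.
Qed.

Lemma quot_bracket_pure (br : q -> q -> q) (br_lie : lie_bracket br)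
    (x y : q) (f g : {poly %/ p}) :
  quot_bracket br p (pure_current n x f) (pure_current n y g) =
  pure_current n (br x y) (f * g).
Proof.
have [[brl brr] _ _] := br_lie.
have brZl z a t : br (a *: t) z = a *: br t z.
  by apply: (scalable_linear (brl z)).
have brZr z a t : br z (a *: t) = a *: br z t.
  by apply: (scalable_linear (brr z)).
rewrite {2}(qpoly_tbarE f) {2}(qpoly_tbarE g) mulr_suml.
apply/ffunP => k; rewrite sum_ffunE ffunE poly_of_qpoly_sum coef_sum.
rewrite scaler_suml; apply: eq_bigr => i _.
rewrite sum_ffunE mulr_sumr poly_of_qpoly_sum coef_sum scaler_suml.
apply: eq_bigr => j _; rewrite !ffunE brZl brZr !scalerA.
rewrite -scalerAl -scalerAr !poly_of_qpolyZ !coefZ.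
by congr (_ *: _); rewrite mulrC mulrA.
Qed.

End QuotientCurrentTheory.

(* Main.v *)
Require Import Defs.
From mathcomp Require Import all_boot all_order all_algebra.

Set Implicit Arguments.
Unset Strict Implicit.
Unset Printing Implicit Defensive.

Import GRing.Theory.
Local Open Scope ring_scope.

(* If f and g have degree less than n, the quotient Q of f * g by p1 has degree
   at most n - 2, so Q * l has degree less than n and reducing f * g modulo
   p1 + c l gives R - c Q l, where R is the remainder modulo p1.  The product
   modulo p1 + c l is thus affine in c, and the sum of the brackets for p1 and
   p1 + l is twice the bracket for p1 + l / 2. *)

Section Bilinear.

Variables (K : fieldType) (V : lmodType K) (b : V -> V -> V).
Hypothesis b_bilinear : bilinear_for *:%R *:%R b.

Lemma bilinear_addl x y z : b (x + y) z = b x z + b y z.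
Proof. by have := b_bilinear.1 z 1 x y; rewrite /= !scale1r. Qed.

Lemma bilinear_addr x y z : b z (x + y) = b z x + b z y.
Proof. by have := b_bilinear.2 z 1 x y; rewrite /= !scale1r. Qed.

Lemma bilinear_0l z : b 0 z = 0.
Proof. by apply: (addrI (b 0 z)); rewrite -bilinear_addl !addr0. Qed.

Lemma bilinear_0r z : b z 0 = 0.
Proof. by apply: (addrI (b z 0)); rewrite -bilinear_addr !addr0. Qed.

Lemma bilinear_scalel a x z : b (a *: x) z = a *: b x z.
Proof. by have := b_bilinear.1 z a x 0; rewrite /= bilinear_0l !addr0. Qed.

Lemma bilinear_scaler a x z : b z (a *: x) = a *: b z x.
Proof. by have := b_bilinear.2 z a x 0; rewrite /= bilinear_0r !addr0. Qed.

Lemma bilinear_altC : (forall x, b x x = 0) -> forall x y, b x y = - b y x.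
Proof.
move=> b_alt x y; apply/eqP; rewrite -addr_eq0; apply/eqP.
by have := b_alt (x + y); rewrite bilinear_addl !bilinear_addr !b_alt add0r addr0.
Qed.

End Bilinear.

(** The Jacobi sum is homogeneous of degree two in the bracket, so scaling by [a] multiplies it by
    [a ^+ 2]. *)
Lemma scale_lie_bracket (K : fieldType) (V : lmodType K) (b c : V -> V -> V)
    (a : K) :
  lie_bracket b -> (forall x y, c x y = a *: b x y) -> lie_bracket c.
Proof.
move=> [b_lin b_alt b_jac] cE; split.
- split=> z k x y; rewrite /= !cE ?(bilinear_addl b_lin, bilinear_addr b_lin).
    by rewrite bilinear_scalel // scalerDr !scalerA mulrC.
  by rewrite bilinear_scaler // scalerDr !scalerA mulrC.
- by move=> x; rewrite cE b_alt scaler0.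
- by move=> x y z; rewrite !cE !(bilinear_scaler b_lin) -!scalerDr b_jac !scaler0.
Qed.

Section QuotientBracketLie.

Variables (K : fieldType) (q : lmodType K) (br : q -> q -> q).
Hypothesis br_lie : lie_bracket br.
Variables (n : nat) (p : {poly K}).
Hypotheses (p_monic : p \is monic) (size_p : size p = n.+1) (n_gt0 : (0 < n)%N).

Local Notation b := (@quot_bracket K q br n p).

Let br_lin : bilinear_for *:%R *:%R br. Proof. by case: br_lie. Qed.

Lemma pure_currentP (f : {poly %/ p}) (a : K) (x y : q) :
  pure_current n (a *: x + y) f =
  a *: pure_current n x f + pure_current n y f.
Proof.
by apply/ffunP => i; rewrite !ffunE scalerDr !scalerA mulrC.
Qed.

Lemma pure_current_sum_zero (f : {poly %/ p}) (x y z : q) :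
  x + y + z = 0 ->
  pure_current n x f + pure_current n y f + pure_current n z f = 0.
Proof.
by move=> xyz0; apply/ffunP => i; rewrite !ffunE -!scalerDr xyz0 scaler0.
Qed.

(** Pure currents span W additively. Additive identities thus reduce to pure currents, where the
    bracket multiplies the polynomial factors in the commutative ring [{poly %/ p}]. *)
Lemma currents_ind (P : currents q n -> Prop) :
  P 0 -> (forall u v, P u -> P v -> P (u + v)) ->
  (forall x (f : {poly %/ p}), P (pure_current n x f)) -> forall u, P u.
Proof.
move=> P0 PD Ppure u; rewrite (currents_tbarE p_monic size_p n_gt0 u).
by apply: big_ind => // i _; apply: Ppure.
Qed.

Lemma quot_bracket_bilinear : bilinear_for *:%R *:%R b.
Proof.
split=> w a u v; rewrite /= /quot_bracket scaler_sumr -big_split.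
  apply: eq_bigr => i _; rewrite scaler_sumr -big_split; apply: eq_bigr => j _.
  by rewrite /= -pure_currentP !ffunE -(br_lin.1 (w j)).
apply: eq_bigr => i _; rewrite scaler_sumr -big_split; apply: eq_bigr => j _.
by rewrite /= -pure_currentP !ffunE -(br_lin.2 (w i)).
Qed.

Let bDl := bilinear_addl quot_bracket_bilinear.
Let bDr := bilinear_addr quot_bracket_bilinear.
Let b0l := bilinear_0l quot_bracket_bilinear.
Let b0r := bilinear_0r quot_bracket_bilinear.
Let b_pure := quot_bracket_pure p_monic size_p n_gt0 br_lie.

(** Alternation is quadratic in its argument, so its induction on sums leaves the cross terms
    [b u v + b v u], which this identity cancels. *)
Lemma quot_bracketC u v : b u v + b v u = 0.
Proof.
elim/currents_ind: u => [|u1 u2 IH1 IH2|x f]; first by rewrite b0l b0r addr0.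
  by rewrite bDl bDr addrACA IH1 IH2 addr0.
elim/currents_ind: v => [|v1 v2 IH1 IH2|y g]; first by rewrite b0l b0r addr0.
  by rewrite bDl bDr addrACA IH1 IH2 addr0.
rewrite !b_pure [g * f]mulrC; apply/ffunP => i; rewrite !ffunE -scalerDr.
by case: br_lie => _ br_alt _; rewrite (bilinear_altC br_lin br_alt) addNr scaler0.
Qed.

Lemma quot_bracket_jacobi u v w : b u (b v w) + b v (b w u) + b w (b u v) = 0.
Proof.
(* The Jacobi sum is additive in each argument: [step] regroups its six terms into the two sums
   given by the induction hypotheses. *)
have step (x1 x2 x3 y1 y2 y3 : currents q n) : x1 + x2 + x3 = 0 ->
    y1 + y2 + y3 = 0 -> (x1 + y1) + (x2 + y2) + (x3 + y3) = 0.
  by move=> x0 y0; rewrite (addrACA x1) (addrACA (x1 + x2)) x0 y0 addr0.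
elim/currents_ind: u => [|u1 u2 IH1 IH2|x f]; first by rewrite !(b0l, b0r) !addr0.
  by rewrite !(bDl, bDr); apply: step.
elim/currents_ind: v => [|v1 v2 IH1 IH2|y g]; first by rewrite !(b0l, b0r) !addr0.
  by rewrite !(bDl, bDr); apply: step.
elim/currents_ind: w => [|w1 w2 IH1 IH2|z h]; first by rewrite !(b0l, b0r) !addr0.
  by rewrite !(bDl, bDr); apply: step.
(* All three polynomial factors become [f * (g * h)], which leaves the Jacobi identity of [br]. *)
rewrite !b_pure [g * (h * f)]mulrA [g * h * f]mulrC [h * (f * g)]mulrC -[f * g * h]mulrA.
by apply: pure_current_sum_zero; case: br_lie.
Qed.

Lemma quot_bracket_lie : lie_bracket b.
Proof.
split; [exact: quot_bracket_bilinear | | exact: quot_bracket_jacobi].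
move=> u; elim/currents_ind: u => [|u v IHu IHv|x f]; first by rewrite b0l.
  by rewrite bDl !bDr IHu IHv add0r addr0 quot_bracketC.
case: br_lie => _ br_alt _; rewrite b_pure br_alt.
by apply/ffunP => i; rewrite !ffunE scaler0.
Qed.

End QuotientBracketLie.

Section Perturbation.

Variables (K : fieldType) (n : nat) (p l : {poly K}).
Hypotheses (n_gt1 : (1 < n)%N) (p_monic : p \is monic) (size_p : size p = n.+1).
Hypothesis size_l : (size l <= 2)%N.

Lemma size_perturb : size (p + l) = n.+1.
Proof. by rewrite size_polyDl size_p // ltnS (leq_trans size_l). Qed.

Lemma monic_perturb : p + l \is monic.
Proof.
by rewrite monicE lead_coefDl ?size_p ?ltnS ?(leq_trans size_l) // -monicE.
Qed.

(** With [f = Q * p + R] one has [f = Q * (p + l) + (R - Q * l)]. Uniqueness of Euclidean division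
    applies because [R - Q * l] has degree less than [n]. *)
Lemma modp_perturb (f : {poly K}) : (size f < n.*2)%N ->
  f %% (p + l) = f %% p - (f %/ p) * l.
Proof.
move=> size_f; apply/esym/(@modpP _ _ (f %/ p)).
  by rewrite mulrDr addrACA subrr addr0 -divp_eq.
rewrite size_perturb; apply: leq_ltn_trans (size_polyD _ _) _.
rewrite gtn_max size_polyN -{1}size_p ltn_modp monic_neq0 //= ltnS.
apply: leq_trans (size_polyMleq _ _) _.
rewrite size_divp ?monic_neq0 // size_p /=.
(* The quotient has size at most [n - 1], so its product with [l] has size at most
   [(n - 1) + 2 - 1 = n]. *)
have : (size f - n <= n.-1)%N by rewrite leq_subLR -ltnS -addnS prednK ?addnn // ltnW.
move=> size_Q; rewrite -subn1 leq_subLR; apply: leq_trans (leq_add size_Q size_l) _.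
by rewrite addn2 prednK // ltnW.
Qed.

End Perturbation.

(** Since [i + j] may reach [n], a genuine remainder appears; it is expressed with [%%] so that
    [modp_perturb] applies. *)
Lemma tbarX_mulE (K : fieldType) (n : nat) (p : {poly K}) (i j : nat) :
  p \is monic -> size p = n.+1 -> (0 < n)%N ->
  (in_qpoly p 'X) ^+ i * (in_qpoly p 'X) ^+ j = 'X^(i + j) %% p :> {poly K}.
Proof.
move=> p_monic size_p n_gt0.
have tX k : (in_qpoly p 'X) ^+ k = in_qpoly p 'X^k.
  elim: k => [|k IH]; first by rewrite !expr0 in_qpoly1.
  by rewrite !exprS IH in_qpolyM.
rewrite -exprD tX /= /mk_monic size_p p_monic ltnS n_gt0 /=.
by rewrite Pdiv.IdomainMonic.modpE.
Qed.

(** The moduli [p], [p + l], [p + (l + l)] are in arithmetic progression, and the remainders are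
    affine along it; the middle bracket is the mean of the outer two. *)
Lemma quot_bracket_perturbD (K : fieldType) (q : lmodType K)
    (br : q -> q -> q) (n : nat) (p l : {poly K}) (u v : currents q n) :
  (1 < n)%N -> p \is monic -> size p = n.+1 -> (size l <= 2)%N ->
  quot_bracket br p u v + quot_bracket br (p + (l + l)) u v =
  2%:R *: quot_bracket br (p + l) u v.
Proof.
move=> n_gt1 p_monic size_p size_l; have n_gt0 := ltnW n_gt1.
have size_ll : (size (l + l)%R <= 2)%N.
  by apply: leq_trans (size_polyD _ _) _; rewrite maxnn.
rewrite /quot_bracket scaler_sumr -big_split; apply: eq_bigr => i _.
rewrite scaler_sumr -big_split; apply: eq_bigr => j _.
(* Both exponents are at most [n - 1], so the degree is at most [2n - 2], as [modp_perturb]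
   requires. *)
have size_Xij : (size ('X^(i + j) : {poly K})%R < n.*2)%N.
  by rewrite size_polyXn -addnn -addnS -addSn leq_add.
apply/ffunP => k; rewrite !ffunE (tbarX_mulE _ _ p_monic size_p) //.
rewrite !(@tbarX_mulE K n (p + _)) ?(monic_perturb n_gt1) ?(size_perturb n_gt1 size_p) //.
rewrite !(modp_perturb n_gt1) // scalerA -scalerDl; congr (_ *: _).
by rewrite mulr_natl mulr2n mulrDr !(coefB, coefD) [RHS]addrACA opprD [LHS]addrA.
Qed.

Theorem proposition2p6 (K : closedFieldType) (charK0 : [pchar K] =i pred0)
    (q : lmodType K) (br : q -> q -> q) (br_lie : lie_bracket br)
    (n : nat) (n_ge2 : (2 <= n)%N)
    (p1 : {poly K}) (p1_monic : p1 \is monic) (size_p1 : size p1 = n.+1)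
    (l : {poly K}) (l_neq0 : l != 0) (size_l : (size l <= 2)%N)
    (p2 : {poly K}) (p2E : p2 = p1 + l) :
  compatible_brackets (@quot_bracket K q br n p1) (@quot_bracket K q br n p2).
Proof.
have n_gt0 := ltnW n_ge2; have two_neq0 : 2%:R != 0 :> K.
  by rewrite ((pcharf0P K).1 charK0).
(* Stated for a general [m] because it serves both [l], for the bracket of [p2], and [h], for the
   midpoint bracket. *)
have lie_perturb (m : {poly K}) : (size m <= 2)%N -> lie_bracket (@quot_bracket K q br n (p1 + m)).
  move=> size_m; apply: quot_bracket_lie => //.
    exact: (monic_perturb n_ge2 p1_monic size_p1 size_m).
  exact: (size_perturb n_ge2 size_p1 size_m).
(* Characteristic 0 allows halving [l]; [p1 + h] is the midpoint of [p1] and [p2]. *)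
pose h := 2%:R^-1 *: l.
have hh : h + h = l by rewrite -mulr2n -scaler_nat scalerA divff // scale1r.
have size_h : (size h <= 2)%N by rewrite size_scale // invr_eq0.
split; [exact: quot_bracket_lie | by rewrite p2E; apply: lie_perturb |].
apply: (scale_lie_bracket (a := 2%:R) (lie_perturb h size_h)) => u v.
by rewrite /add_bracket p2E -hh quot_bracket_perturbD.
Qed.
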